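(* Let $X$ and $Y$ be quasi-normed spaces and $n\ge1$. There is a constant $C\ge1$, depending only on $n$ and the quasi-triangle constants of $X$ and $Y$, such that the following hold for all $\vec x\in X\otimes\mathbb R^n$ and $\vec y\in Y\otimes\mathbb R^n$. (a) If $X$ is a quasi-normed function lattice, then $$C^{-1}\|\vec x\odot\vec y\|_{X(Y)}\le\big|[\vec x]_X[\vec y]_Y\big|\le C\,\|\vec x\odot\vec y\|_{X(Y)}.$$ (b) If $Y$ is a quasi-normed function lattice, then $$C^{-1}\|\vec x\odot\vec y\|_{Y(X)}\le\big|[\vec x]_X[\vec y]_Y\big|\le C\,\|\vec x\odot\vec y\|_{Y(X)}.$$ In particular, if both $X$ and $Y$ are quasi-normed function lattices, then the three quantities $|[\vec x]_X[\vec y]_Y|$, $\|\vec x\odot\vec y\|_{X(Y)}$ and $\|\vec x\odot\vec y\|_{Y(X)}$ are all comparable, with constants depending only on $n$ and the quasi-triangle constants of $X$ and $Y$.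
   Context: All vector spaces are real. A quasi-norm satisfies the axioms of a norm except that the triangle inequality is relaxed to $\|x+y\|\le K(\|x\|+\|y\|)$ for a constant $K\ge1$ (the quasi-triangle constant); a quasi-normed space is a vector space with a quasi-norm, not necessarily complete. Elements of $X\otimes\mathbb R^n$ are identified with $\vec x=(x_1,\dots,x_n)\in X^n$, and $\vec x\odot\vec y:=\sum_{i=1}^nx_i\otimes y_i\in X\otimes Y$. Function lattices: $X$ is a quasi-normed function lattice if $X\subseteq L^0(S,\mathcal M)$ is a vector space of real measurable functions on a measurable space $(S,\mathcal M)$, equipped with a quasi-norm such that whenever $f\in X$ and $h\in L^0(S,\mathcal M)$ satisfy $|h|\le|f|$ pointwise, then $h\in X$ and $\|h\|_X\le\|f\|_X$. For such $X$ and a quasi-normed space $Y$, define on $X\otimes Y$ $$\Big\|\sum_{i}x_i\otimes y_i\Big\|_{X(Y)}:=\Big\|s\mapsto\Big\|\sum_{i}x_i(s)y_i\Big\|_Y\Big\|_X,$$ where it is understood that the function of $s$ inside is measurable. If $Y$ is a quasi-normed function lattice, $\|\vec x\odot\vec y\|_{Y(X)}$ is defined analogously with the roles of $X$ and $Y$ exchanged: $\|\vec x\odot\vec y\|_{Y(X)}=\big\|t\mapsto\|\sum_iy_i(t)x_i\|_X\big\|_Y$. Reducing matrices: for a quasi-normed space $X$ with quasi-triangle constant $K$, $\vec x\in X^n$ and $\vec e\in\mathbb R^n$, put $\vec x\cdot\vec e:=\sum_{i=1}^n e_ix_i\in X$. Then $[\vec x]_X$ denotes any positive semi-definite $n\times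 n$ matrix with $c^{-1}|[\vec x]_X\vec e|\le\|\vec x\cdot\vec e\|_X\le c\,|[\vec x]_X\vec e|$ for all $\vec e\in\mathbb R^n$, where $c=c(n,K)\ge1$ is a fixed constant depending only on $n$ and $K$, for which such a matrix always exists. The matrix is not unique; the statement holds for any choice. $|\cdot|$ is the Euclidean norm of vectors and the corresponding operator norm of matrices. *)

(* Defs.v *)
From HB Require Import structures.
From mathcomp Require Import all_boot all_order all_algebra.
From mathcomp Require Import all_classical all_reals all_analysis.

Set Implicit Arguments.
Unset Strict Implicit.
Unset Printing Implicit Defensive.

Import Order.TTheory GRing.Theory Num.Theory.
Import numFieldNormedType.Exports.

Local Open Scope classical_set_scope.
Local Open Scope ring_scope.

(* A quasi-normed space with quasi-triangle constant K is carried by a linear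
   subspace of an ambient vector space V, so that function lattices, which are
   subspaces of S -> R, are literally instances; an abstract vector space V is
   the case where the subspace is all of V.  The values of qnorm outside the
   subspace are irrelevant. *)
Record quasiNormedSpace (R : realType) (V : lmodType R) (K : R) :=
  QuasiNormedSpace {
    qn_carrier :> {pred V} ;
    qnorm : V -> R ;
    qn_submod : submod_closed qn_carrier ;
    qn_ge1 : 1 <= K ;
    qnorm_ge0 : forall u, u \in qn_carrier -> 0 <= qnorm u ;
    qnorm_eq0 : forall u, u \in qn_carrier -> qnorm u = 0 -> u = 0 ;
    qnormZ : forall (a : R) u, u \in qn_carrier ->
      qnorm (a *: u) = `|a| * qnorm u ;
    qnormD : forall u v, u \in qn_carrier -> v \in qn_carrier ->
      qnorm (u + v) <= K * (qnorm u + qnorm v) }.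

Definition function_lattice (R : realType) (d : measure_display)
    (S : measurableType d) (K : R) (X : quasiNormedSpace (S -> R) K) : Prop :=
  (forall f : S -> R, f \in X -> measurable_fun [set: S] f) /\
  (forall f h : S -> R, f \in X -> measurable_fun [set: S] h ->
     (forall s, `|h s| <= `|f s|) -> h \in X /\ qnorm X h <= qnorm X f).

Section MixedNorm.
Context (R : realType) (d : measure_display) (S : measurableType d).
Context (V : lmodType R) (KX KY : R).
Context (X : quasiNormedSpace (S -> R) KX) (Y : quasiNormedSpace V KY).
Context (n : nat).

Definition fiber_norm (x : 'I_n -> S -> R) (y : 'I_n -> V) : S -> R :=
  fun s => qnorm Y (\sum_(i < n) x i s *: y i).

(* ||sum_i x_i (x) y_i||_{X(Y)}.  When X is a function lattice, the x_i are in
   X and fiber_norm x y is measurable, fiber_norm x y is itself in X by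
   solidity. *)
Definition mixed_norm (x : 'I_n -> S -> R) (y : 'I_n -> V) : R :=
  qnorm X (fiber_norm x y).

End MixedNorm.

(* The norm that the library puts on matrices is the sup norm of the entries,
   hence the explicit Euclidean norm. *)
Definition enorm (R : realType) (n : nat) (v : 'cV[R]_n) : R :=
  Num.sqrt (\sum_(i < n) v i ord0 ^+ 2).

Definition opnorm (R : realType) (n : nat) (A : 'M[R]_n) : R :=
  sup [set enorm (A *m e) | e in [set e : 'cV[R]_n | enorm e <= 1]].

Definition pos_semidef (R : realType) (n : nat) (A : 'M[R]_n) : Prop :=
  A^T = A /\ forall e : 'cV[R]_n, 0 <= (e^T *m A *m e) ord0 ord0.

(* "A is a possible choice of [x]_X", for a fixed constant c = c(n, K). *)
Definition reducing_matrix (R : realType) (c : nat -> R -> R)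
    (V : lmodType R) (K : R) (X : quasiNormedSpace V K) (n : nat)
    (x : 'I_n -> V) (A : 'M[R]_n) : Prop :=
  pos_semidef A /\
  forall e : 'cV[R]_n,
    (c n K)^-1 * enorm (A *m e) <= qnorm X (\sum_(i < n) e i ord0 *: x i)
      <= c n K * enorm (A *m e).

Definition comparable_within (R : realType) (C a b : R) : Prop :=
  C^-1 * a <= b <= C * a.

(* Main.v *)
Require Import Defs.
From HB Require Import structures.
From mathcomp Require Import all_boot all_order all_algebra.
From mathcomp Require Import all_classical all_reals all_analysis.
From mathcomp Require Import ring.

Set Implicit Arguments.
Unset Strict Implicit.
Unset Printing Implicit Defensive.

Import Order.TTheory GRing.Theory Num.Theory.
Import numFieldNormedType.Exports.

Local Open Scope classical_set_scope.
Local Open Scope ring_scope.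


(** Pointwise, ||sum_i x_i(s) y_i||_Y is comparable to |B x(s)|, hence to
    sum_j |g_j(s)| with g_j := sum_i B_ji x_i in X.  As X is a lattice, the mixed
    norm is then comparable to sum_j ||g_j||_X, and since B is symmetric g_j is
    x . (B e_j), so ||g_j||_X is comparable to |A B e_j|.  Thus the mixed norm is
    comparable to the sum of the absolute values of the entries of A B.  The
    roles of X and Y can be exchanged because that sum is invariant under
    transposition and (A B)^T = B A. *)

(** * Calculus of two-sided comparisons *)

Lemma comparable_withinP (R : realType) (C a b : R) : 0 < C ->
  comparable_within C a b <-> a <= C * b /\ b <= C * a.
Proof.
move=> C0; rewrite /comparable_within ler_pdivrMl //.
by split=> [/andP|[-> ->]].
Qed.

(** Comparability is symmetric, so two quantities are compared through a common third one [b]; the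
    constants multiply. *)
Lemma comparable_within_trans (R : realType) (C D a b e : R) :
  0 < C -> 0 < D -> comparable_within C a b -> comparable_within D e b ->
  comparable_within (C * D) a e.
Proof.
move=> C0 D0 /(comparable_withinP _ _ C0)[ab ba].
move=> /(comparable_withinP _ _ D0)[eb be].
apply/comparable_withinP; rewrite ?mulr_gt0 //; split.
  by apply: le_trans ab _; rewrite -mulrA ler_pM2l.
by apply: le_trans eb _; rewrite [C * D]mulrC -mulrA ler_pM2l.
Qed.

(** Nonnegativity of [b] passes to [a], so a larger constant weakens both inequalities. *)
Lemma comparable_within_le (R : realType) (C D a b : R) :
  0 < C -> C <= D -> 0 <= b ->
  comparable_within C a b -> comparable_within D a b.
Proof.
move=> C0 CD b0 /(comparable_withinP _ _ C0)[ab ba].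
have a0 : 0 <= a by rewrite -(pmulr_rge0 _ C0); exact: le_trans ba.
apply/comparable_withinP; first exact: lt_le_trans CD.
by split; [apply: le_trans ab _ | apply: le_trans ba _]; rewrite ler_wpM2r.
Qed.

(** * Euclidean norm, operator norm and entries of a matrix *)

Lemma abs_coord_le_enorm (R : realType) (n : nat) (v : 'cV[R]_n) (i : 'I_n) :
  `|v i ord0| <= enorm v.
Proof.
rewrite /enorm -sqrtr_sqr ler_sqrt; last by apply: sumr_ge0 => j _; exact: sqr_ge0.
by rewrite (bigD1 i) //= lerDl; apply: sumr_ge0 => j _; exact: sqr_ge0.
Qed.

(** After squaring, each [v_i ^+ 2] is at most [|v_i|] times the whole sum of absolute values. *)
Lemma enorm_le_sum_abs (R : realType) (n : nat) (v : 'cV[R]_n) :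
  enorm v <= \sum_(i < n) `|v i ord0|.
Proof.
have s0 : 0 <= \sum_(i < n) `|v i ord0| by exact: sumr_ge0.
rewrite /enorm -[leRHS]ger0_norm // -[leRHS]sqrtr_sqr ler_sqrt ?sqr_ge0 //.
rewrite expr2 mulr_suml; apply: ler_sum => i _.
rewrite -real_normK ?num_real // expr2 ler_wpM2l //.
by rewrite (bigD1 i) //= lerDl sumr_ge0.
Qed.

Definition entry_sum (R : realType) (n : nat) (M : 'M[R]_n) : R :=
  \sum_(i < n) \sum_(j < n) `|M i j|.

Lemma entry_sum_ge0 (R : realType) (n : nat) (M : 'M[R]_n) : 0 <= entry_sum M.
Proof. by apply: sumr_ge0 => i _; exact: sumr_ge0. Qed.

Lemma entry_sum_tr (R : realType) (n : nat) (M : 'M[R]_n) :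
  entry_sum M^T = entry_sum M.
Proof.
rewrite /entry_sum exchange_big; apply: eq_bigr => i _.
by apply: eq_bigr => j _; rewrite mxE.
Qed.

Lemma entry_sum_le (R : realType) (n : nat) (M : 'M[R]_n) (b : R) :
  (forall i j, `|M i j| <= b) -> entry_sum M <= n%:R ^+ 2 * b.
Proof.
move=> Mb; have -> : n%:R ^+ 2 * b = \sum_(i < n) \sum_(j < n) b.
  by rewrite -natrX mulr_natl !sumr_const card_ord -mulrnA mulnn.
by apply: ler_sum => i _; exact: ler_sum.
Qed.

Lemma enorm_mulmx_le_entry_sum (R : realType) (n : nat) (M : 'M[R]_n)
    (e : 'cV[R]_n) : enorm e <= 1 -> enorm (M *m e) <= entry_sum M.
Proof.
move=> e1; apply: le_trans (enorm_le_sum_abs _) _; apply: ler_sum => i _.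
rewrite mxE; apply: le_trans (ler_norm_sum _ _ _) _; apply: ler_sum => j _.
rewrite normrM ler_piMr //; exact: le_trans (abs_coord_le_enorm _ _) e1.
Qed.

Lemma opnorm_le_entry_sum (R : realType) (n : nat) (M : 'M[R]_n) :
  opnorm M <= entry_sum M.
Proof.
apply: ge_sup => [|_ [e e1 <-]]; last exact: enorm_mulmx_le_entry_sum.
(* The zero vector shows that the supremum is over a nonempty set. *)
exists (enorm (M *m 0)), 0 => //=; rewrite /enorm.
by rewrite big1 ?sqrtr0 // => i _; rewrite mxE expr0n.
Qed.

(** Each entry is a coordinate of the image of a standard basis vector, hence at most [opnorm M],
    and there are [n ^ 2] entries. *)
Lemma entry_sum_le_opnorm (R : realType) (n : nat) (M : 'M[R]_n) :
  entry_sum M <= n%:R ^+ 2 * opnorm M.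
Proof.
apply: entry_sum_le => i j.
pose e : 'cV[R]_n := delta_mx j ord0.
have -> : M i j = (M *m e) i ord0 by rewrite -colE mxE.
apply: le_trans (abs_coord_le_enorm _ _) _.
apply: ub_le_sup.
  (* An element lies below [sup] only once the set is known to be bounded above. *)
  by exists (entry_sum M) => _ [v v1 <-]; exact: enorm_mulmx_le_entry_sum.
exists e => //=.
apply: le_trans (enorm_le_sum_abs _) _.
rewrite (bigD1 j) //= big1 => [|k kj]; rewrite mxE ?(negbTE kj) ?normr0 //.
by rewrite !eqxx normr1 addr0.
Qed.

Lemma comparable_opnorm_entry_sum (R : realType) (n : nat) (M : 'M[R]_n) :
  (0 < n)%N -> comparable_within (n%:R ^+ 2) (opnorm M) (entry_sum M).
Proof.
move=> n0; have n1 : 1 <= n%:R ^+ 2 :> R by rewrite exprn_ege1 // ler1n.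
apply/comparable_withinP; first exact: lt_le_trans n1.
split; last exact: entry_sum_le_opnorm.
apply: le_trans (opnorm_le_entry_sum _) _.
by rewrite ler_peMl // entry_sum_ge0.
Qed.

(** * Finite sums in quasi-normed spaces *)

Section QuasiNormedSpaceTheory.
Context (R : realType) (V : lmodType R) (K : R) (X : quasiNormedSpace V K).

Lemma qn_mem0 : 0 \in X.
Proof. by case: (qn_submod X). Qed.

Lemma qn_memZ (a : R) (u : V) : u \in X -> a *: u \in X.
Proof. by move=> uX; rewrite -[a *: u]addr0 (qn_submod X).2 // qn_mem0. Qed.

Lemma qn_memD (u v : V) : u \in X -> v \in X -> u + v \in X.
Proof. by move=> uX vX; rewrite -[u]scale1r (qn_submod X).2. Qed.

Lemma qn_mem_sum (I : Type) (r : seq I) (u : I -> V) :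
  (forall i, u i \in X) -> \sum_(i <- r) u i \in X.
Proof.
by move=> uX; elim/big_ind: _ => //; [exact: qn_mem0 | exact: qn_memD].
Qed.

(** Splitting off one summand costs one factor [K], and [K >= 1] lets the split-off term absorb the
    remaining power. The induction starts at the empty sum, hence the exponent [size r]. *)
Lemma qnorm_sum_le (I : Type) (r : seq I) (u : I -> V) :
  (forall i, u i \in X) ->
  qnorm X (\sum_(i <- r) u i) <= K ^+ size r * \sum_(i <- r) qnorm X (u i).
Proof.
move=> uX; elim: r => [|i r IH].
  (* Homogeneity gives that the zero vector has quasi-norm 0. *)
  by rewrite !big_nil -(scale0r 0) qnormZ ?qn_mem0 // normr0 mul0r mulr0.
have K1 := qn_ge1 X; have K0 : 0 <= K := le_trans ler01 K1.
rewrite !big_cons /= exprS; apply: le_trans (qnormD (uX i) (qn_mem_sum r uX)) _.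
rewrite -mulrA ler_wpM2l // mulrDr lerD //.
by rewrite ler_peMl ?qnorm_ge0 // exprn_ege1.
Qed.

End QuasiNormedSpaceTheory.

(** * Consequences of solidity *)

Section FunctionLatticeTheory.
Context (R : realType) (d : measure_display) (S : measurableType d) (K : R).
Context (X : quasiNormedSpace (S -> R) K) (latX : function_lattice X).

Lemma lattice_abs (f : S -> R) : f \in X ->
  (fun s => `|f s|) \in X /\ qnorm X (fun s => `|f s|) <= qnorm X f.
Proof.
move=> fX; apply: latX.2 => // [|s]; last by rewrite normr_id.
apply: measurableT_comp => //; exact: latX.1.
Qed.

(** Solidity applies to [b] times the sum of the [|g i|], itself in [X]. The membership part is what
    places [fiber_norm] in [X]. *)
Lemma lattice_dominated (I : Type) (r : seq I) (g : I -> S -> R) (f : S -> R)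
    (b : R) :
  0 <= b -> (forall i, g i \in X) -> measurable_fun [set: S] f ->
  (forall s, `|f s| <= b * \sum_(i <- r) `|g i s|) ->
  f \in X /\ qnorm X f <= b * (K ^+ size r * \sum_(i <- r) qnorm X (g i)).
Proof.
move=> b0 gX mf fg; pose h := \sum_(i <- r) (fun s => `|g i s|).
have absX i := (lattice_abs (gX i)).1.
have hX : h \in X by exact: qn_mem_sum.
have [|fX fh] := latX.2 (b *: h) f (qn_memZ b hX) mf.
  move=> s; apply: le_trans (fg s) (le_trans _ (ler_norm _)).
  by rewrite /h fct_sumE.
split=> //; apply: le_trans fh _; rewrite qnormZ // ger0_norm // ler_wpM2l //.
apply: le_trans (qnorm_sum_le r absX) _.
rewrite ler_wpM2l ?exprn_ge0 ?(le_trans ler01 (qn_ge1 X)) //.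
by apply: ler_sum => i _; case: (lattice_abs (gX i)).
Qed.

End FunctionLatticeTheory.

(** * Mixed norms against the entries of the product of reducing matrices *)

Lemma mixed_norm_entry_sum (R : realType) (c : nat -> R -> R) (n : nat)
    (KX KY : R) (d : measure_display) (S : measurableType d) (W : lmodType R)
    (X : quasiNormedSpace (S -> R) KX) (Y : quasiNormedSpace W KY)
    (x : 'I_n -> S -> R) (y : 'I_n -> W) (A B : 'M[R]_n) :
  1 <= c n KX -> 1 <= c n KY -> function_lattice X ->
  (forall i, x i \in X) -> (forall i, y i \in Y) ->
  reducing_matrix c X x A -> reducing_matrix c Y y B ->
  measurable_fun [set: S] (fiber_norm Y x y) ->
  mixed_norm X Y x y <= c n KX * c n KY * KX ^+ n * entry_sum (A *m B) /\
  entry_sum (A *m B) <= n%:R ^+ 2 * (c n KX * c n KY * mixed_norm X Y x y).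
Proof.
set cX := c n KX; set cY := c n KY.
move=> cX1 cY1 latX xX yY [_ hA] [[Bsym _] hB] mf.
have cX0 : 0 < cX := lt_le_trans ltr01 cX1.
have cY0 : 0 < cY := lt_le_trans ltr01 cY1.
have KX0 : 0 <= KX := le_trans ler01 (qn_ge1 X).
pose xs s : 'cV[R]_n := \col_i x i s.
(* Coefficients are taken from column [j] of [B] to apply the bound for [A]; symmetry of [B] turns
   them into row [j], so that [g j s] is a coordinate of [B *m xs s]. *)
pose g j : S -> R := \sum_(i < n) B i j *: x i.
have gX j : g j \in X by apply: qn_mem_sum => i; exact: qn_memZ.
have gE j s : g j s = (B *m xs s) j ord0.
  rewrite /g fct_sumE mxE; apply: eq_bigr => i _.
  by rewrite -[in RHS]Bsym !mxE.
have hg j : cX^-1 * enorm (col j (A *m B)) <= qnorm X (g j)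
    <= cX * enorm (col j (A *m B)).
  have -> : col j (A *m B) = A *m col j B by rewrite !colE mulmxA.
  by have := hA (col j B); under eq_bigr do rewrite mxE.
have hf s : cY^-1 * enorm (B *m xs s) <= fiber_norm Y x y s
    <= cY * enorm (B *m xs s).
  by have := hB (xs s); under eq_bigr do rewrite mxE.
have f0 s : 0 <= fiber_norm Y x y s.
  by apply: qnorm_ge0; apply: qn_mem_sum => i; exact: qn_memZ.
have fg s : `|fiber_norm Y x y s| <= cY * \sum_(j < n) `|g j s|.
  rewrite ger0_norm //; case/andP: (hf s) => _ /le_trans; apply.
  rewrite ler_pM2l //; apply: le_trans (enorm_le_sum_abs _) _.
  by apply: ler_sum => j _; rewrite gE.
have [fX fle] := lattice_dominated latX (ltW cY0) gX mf fg.
split.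
  (* Upper bound: [KX ^+ n] comes from adding the [n] functions [|g j|] in [X]. *)
  apply: le_trans fle _.
  have -> : size (index_enum 'I_n) = n.
    by rewrite [index_enum _]unlock -enumT size_enum_ord.
  have -> : cX * cY * KX ^+ n * entry_sum (A *m B)
      = cY * (KX ^+ n * (cX * entry_sum (A *m B))) by ring.
  rewrite ler_pM2l // ler_wpM2l ?exprn_ge0 //.
  (* Transposing groups the entries by columns, one column for each [g j]. *)
  rewrite -entry_sum_tr /entry_sum mulr_sumr; apply: ler_sum => j _.
  case/andP: (hg j) => _ /le_trans; apply; rewrite ler_pM2l //.
  apply: le_trans (enorm_le_sum_abs _) _.
  by apply: ler_sum => i _; rewrite !mxE.
(* Lower bound: the entries are estimated one by one, which costs [n ^ 2]. *)
apply: entry_sum_le => i j.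
have -> : (A *m B) i j = col j (A *m B) i ord0 by rewrite [RHS]mxE.
apply: le_trans (abs_coord_le_enorm _ _) _.
have : enorm (col j (A *m B)) <= cX * qnorm X (g j).
  by rewrite -ler_pdivrMl //; case/andP: (hg j).
move=> /le_trans; apply; rewrite -mulrA ler_pM2l //.
(* The factor [cY] moves inside the quasi-norm, so that solidity applies to the pointwise bound of
   [|g j|] by [cY] times the fiber norm. *)
rewrite -[cY]gtr0_norm // -(qnormZ cY fX).
apply: (latX.2 _ _ (qn_memZ cY fX) (latX.1 _ (gX j)) _).2 => s.
rewrite gE; apply: le_trans (abs_coord_le_enorm _ _) (le_trans _ (ler_norm _)).
by rewrite -ler_pdivrMl //; case/andP: (hf s).
Qed.

(** The factor [KY ^+ n] makes the constant symmetric in [X] and [Y], so that the same one serves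
    after exchanging the two spaces. *)
Lemma comparable_mixed_norm_entry_sum (R : realType) (c : nat -> R -> R)
    (n : nat) (KX KY : R) (d : measure_display) (S : measurableType d)
    (W : lmodType R)
    (X : quasiNormedSpace (S -> R) KX) (Y : quasiNormedSpace W KY)
    (x : 'I_n -> S -> R) (y : 'I_n -> W) (A B : 'M[R]_n) :
  (0 < n)%N -> 1 <= c n KX -> 1 <= c n KY -> function_lattice X ->
  (forall i, x i \in X) -> (forall i, y i \in Y) ->
  reducing_matrix c X x A -> reducing_matrix c Y y B ->
  measurable_fun [set: S] (fiber_norm Y x y) ->
  comparable_within (n%:R ^+ 2 * (c n KX * c n KY) * (KX ^+ n * KY ^+ n))
    (mixed_norm X Y x y) (entry_sum (A *m B)).
Proof.
move=> n0 cX1 cY1 latX xX yY hA hB mf.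
have [fN Nf] := mixed_norm_entry_sum cX1 cY1 latX xX yY hA hB mf.
have n1 : 1 <= n%:R ^+ 2 :> R by rewrite exprn_ege1 // ler1n.
have c1 : 1 <= c n KX * c n KY by rewrite mulr_ege1.
have KX1 : 1 <= KX ^+ n by rewrite exprn_ege1 // (qn_ge1 X).
have KY1 : 1 <= KY ^+ n by rewrite exprn_ege1 // (qn_ge1 Y).
have N0 := entry_sum_ge0 (A *m B).
set a := n%:R ^+ 2 in n1 Nf *; set b := c n KX * c n KY in c1 fN Nf *.
set p := KX ^+ n in KX1 fN *; set q := KY ^+ n in KY1 *.
have ab1 : 1 <= a * b by rewrite mulr_ege1.
have pq1 : 1 <= p * q by rewrite mulr_ege1.
(* Nonnegativity is read off the bound [Nf], whose left side is nonnegative. *)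
have f0 : 0 <= mixed_norm X Y x y.
  by rewrite -(pmulr_rge0 _ (lt_le_trans ltr01 ab1)) -mulrA (le_trans N0).
apply/comparable_withinP; first by rewrite (lt_le_trans ltr01) // mulr_ege1.
split.
  apply: le_trans fN _; rewrite ler_wpM2r //.
  have -> : a * b * (p * q) = b * p * (a * q) by ring.
  apply: ler_peMr; first exact: le_trans ler01 (mulr_ege1 c1 KX1).
  exact: mulr_ege1.
apply: le_trans Nf _; rewrite mulrA ler_wpM2r // ler_peMr //.
exact: le_trans ler01 ab1.
Qed.

(** * Uniform constants and the exchange of the two spaces *)

Theorem proposition3p5 (R : realType) (c : nat -> R -> R)
    (hc : forall (m : nat) (K : R), (0 < m)%N -> 1 <= K -> 1 <= c m K)
    (n : nat) (hn : (0 < n)%N)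
    (KX KY : R) (hKX : 1 <= KX) (hKY : 1 <= KY) :
  (exists2 C : R, 1 <= C &
    (forall (d : measure_display) (S : measurableType d) (W : lmodType R)
        (X : quasiNormedSpace (S -> R) KX) (Y : quasiNormedSpace W KY)
        (x : 'I_n -> S -> R) (y : 'I_n -> W) (A B : 'M[R]_n),
      function_lattice X ->
      (forall i, x i \in X) -> (forall i, y i \in Y) ->
      reducing_matrix c X x A -> reducing_matrix c Y y B ->
      measurable_fun [set: S] (fiber_norm Y x y) ->
      comparable_within C (mixed_norm X Y x y) (opnorm (A *m B)))
    /\
    (forall (d : measure_display) (T : measurableType d) (V : lmodType R)
        (X : quasiNormedSpace V KX) (Y : quasiNormedSpace (T -> R) KY)
        (x : 'I_n -> V) (y : 'I_n -> T -> R) (A B : 'M[R]_n),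
      function_lattice Y ->
      (forall i, x i \in X) -> (forall i, y i \in Y) ->
      reducing_matrix c X x A -> reducing_matrix c Y y B ->
      measurable_fun [set: T] (fiber_norm X y x) ->
      comparable_within C (mixed_norm Y X y x) (opnorm (A *m B))))
  /\
  (exists2 C' : R, 1 <= C' &
    forall (d d' : measure_display) (S : measurableType d)
        (T : measurableType d')
        (X : quasiNormedSpace (S -> R) KX) (Y : quasiNormedSpace (T -> R) KY)
        (x : 'I_n -> S -> R) (y : 'I_n -> T -> R) (A B : 'M[R]_n),
      function_lattice X -> function_lattice Y ->
      (forall i, x i \in X) -> (forall i, y i \in Y) ->
      reducing_matrix c X x A -> reducing_matrix c Y y B ->
      measurable_fun [set: S] (fiber_norm Y x y) ->
      measurable_fun [set: T] (fiber_norm X y x) ->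
      [/\ comparable_within C' (mixed_norm X Y x y) (opnorm (A *m B)),
          comparable_within C' (mixed_norm Y X y x) (opnorm (A *m B)) &
          comparable_within C' (mixed_norm X Y x y) (mixed_norm Y X y x)]).
Proof.
have cX1 := hc _ _ hn hKX; have cY1 := hc _ _ hn hKY.
set a : R := n%:R ^+ 2; set b := c n KX * c n KY.
(* [D] compares a mixed norm with [entry_sum]; the extra factor [a] passes from [entry_sum] to
   [opnorm]. *)
pose D := a * b * (KX ^+ n * KY ^+ n); pose C := D * a.
have a1 : 1 <= a by rewrite exprn_ege1 // ler1n.
have b1 : 1 <= b by rewrite mulr_ege1.
have D1 : 1 <= D by do 2!apply: mulr_ege1 => //; exact: exprn_ege1.
have C1 : 1 <= C by rewrite mulr_ege1.
have gt0 (z : R) : 1 <= z -> 0 < z by exact: lt_le_trans.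
have partA d (S : measurableType d) (W : lmodType R)
    (X : quasiNormedSpace (S -> R) KX) (Y : quasiNormedSpace W KY)
    (x : 'I_n -> S -> R) (y : 'I_n -> W) (A B : 'M[R]_n) :
    function_lattice X -> (forall i, x i \in X) -> (forall i, y i \in Y) ->
    reducing_matrix c X x A -> reducing_matrix c Y y B ->
    measurable_fun [set: S] (fiber_norm Y x y) ->
    comparable_within C (mixed_norm X Y x y) (opnorm (A *m B)).
  move=> latX xX yY hA hB mf.
  apply: (comparable_within_trans (gt0 _ D1) (gt0 _ a1)); last first.
    exact: comparable_opnorm_entry_sum.
  exact: comparable_mixed_norm_entry_sum.
have partB d (T : measurableType d) (V : lmodType R)
    (X : quasiNormedSpace V KX) (Y : quasiNormedSpace (T -> R) KY)
    (x : 'I_n -> V) (y : 'I_n -> T -> R) (A B : 'M[R]_n) :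
    function_lattice Y -> (forall i, x i \in X) -> (forall i, y i \in Y) ->
    reducing_matrix c X x A -> reducing_matrix c Y y B ->
    measurable_fun [set: T] (fiber_norm X y x) ->
    comparable_within C (mixed_norm Y X y x) (opnorm (A *m B)).
  move=> latY xX yY hA hB mf.
  apply: (comparable_within_trans (gt0 _ D1) (gt0 _ a1)); last first.
    exact: comparable_opnorm_entry_sum.
  (* Both matrices are symmetric, so the transpose of [A *m B] is [B *m A], the product belonging to
     the exchanged roles. *)
  rewrite -entry_sum_tr trmx_mul hA.1.1 hB.1.1 /D /b.
  rewrite [c n KX * _]mulrC [KX ^+ n * _]mulrC.
  exact: comparable_mixed_norm_entry_sum.
split; first by exists C.
(* Comparing the two mixed norms through [opnorm] uses [C] twice; the other two comparisons are
   weakened to this constant. *)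
have CC : C <= C * C by rewrite ler_peMr // ltW // gt0.
exists (C * C) => [|d d' S T X Y x y A B latX latY xX yY hA hB mX mY].
  exact: le_trans CC.
have hX := partA _ _ _ _ _ _ _ _ _ latX xX yY hA hB mX.
have hY := partB _ _ _ _ _ _ _ _ _ latY xX yY hA hB mY.
have M0 : 0 <= opnorm (A *m B).
  rewrite -(pmulr_rge0 _ (gt0 _ a1)).
  exact: le_trans (entry_sum_ge0 _) (entry_sum_le_opnorm _).
split; [exact: comparable_within_le (gt0 _ C1) CC M0 hX |
        exact: comparable_within_le (gt0 _ C1) CC M0 hY |].
exact: comparable_within_trans (gt0 _ C1) (gt0 _ C1) hX hY.
Qed.
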